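(* A decomposable curve may be Gorenstein only if it is a node. That is, let $X$ be a (germ of a) curve, possibly non-reduced, obtained by gluing two curves $X_1$ and $X_2$ along a reduced closed point. If $X$ is Gorenstein at the gluing point, then $X$ has an ordinary node there.
   Context: Curves are over $\mathbb C$ and Cohen–Macaulay (no embedded points), possibly non-reduced. A curve is Gorenstein if its dualising sheaf is a line bundle. A curve is *decomposable* if it is obtained by gluing two curves along a (reduced closed) point; in terms of local rings, $\mathcal O_X=\mathcal O_{X_1}\times_{\mathbb C}\mathcal O_{X_2}$, the fibre product over the residue field $\mathbb C$. A node is a point with complete local ring $\mathbb C[\![x,y]\!]/(xy)$. *)

(* Defs.v *)
From HB Require Import structures.
From mathcomp Require Import all_boot all_order all_algebra.
From mathcomp Require Import boolp classical_sets functions reals.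
From mathcomp Require Export complex.

Set Implicit Arguments.
Unset Strict Implicit.
Unset Printing Implicit Defensive.

Import Order.TTheory GRing.Theory.
Local Open Scope classical_set_scope.
Local Open Scope ring_scope.

Section Ideals.
Variable A : comPzRingType.
Implicit Types (I J : set A).

(* Ideals are Prop-valued sets and may be the unit ideal, unlike those of
   ring_quotient. *)
Definition is_ideal I : Prop :=
  I 0 /\ forall a u v, I u -> I v -> I (a * u + v).

Definition is_prime I : Prop :=
  [/\ is_ideal I, ~ I 1 & forall u v, I (u * v) -> I u \/ I v].

Definition ideal_gen (S : set A) : set A :=
  [set x | forall J, is_ideal J -> S `<=` J -> J x].

Definition ideal_mul I J : set A :=
  ideal_gen [set x | exists u v, [/\ I u, J v & x = u * v]].

Definition ideal_exp I (n : nat) : set A := iter n (ideal_mul I) setT.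

Definition noetherian : Prop :=
  forall I, is_ideal I -> exists n (g : 'I_n -> A), I = ideal_gen (range g).

Definition prime_chain (n : nat) (P : nat -> set A) : Prop :=
  (forall i, (i <= n)%N -> is_prime (P i)) /\
  (forall i, (i < n)%N -> P i `<` P i.+1).

Definition krull_dim (d : nat) : Prop :=
  (exists P, prime_chain d P) /\
  (forall n P, prime_chain n P -> (n <= d)%N).

End Ideals.

Arguments noetherian A : clear implicits.
Arguments krull_dim A d : clear implicits.

Definition nonunits (A : comUnitRingType) : set A :=
  [set x | x \isn't a GRing.unit].
Arguments nonunits A : clear implicits.

Definition is_local (A : comUnitRingType) : Prop := is_ideal (nonunits A).

Section Modules.
Variable A : comUnitRingType.

Definition fin_gen (M : lmodType A) : Prop :=
  exists n (g : 'I_n -> M),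
    forall v, exists a : 'I_n -> A, v = \sum_i a i *: g i.

Definition free_rank1 (M : lmodType A) : Prop :=
  exists e : M, forall v, exists! a : A, v = a *: e.

(* [regular_mod N s]: s is a regular sequence on M / N. *)
Fixpoint regular_mod (M : lmodType A) (N : set M) (s : seq A) : Prop :=
  if s is x :: s' then
    (forall v, N (x *: v) -> N v) /\
    regular_mod [set w | exists u v, N u /\ w = u + x *: v] s'
  else N <> setT.

Definition regular_seq (M : lmodType A) (s : seq A) : Prop :=
  regular_mod [set (0 : M)] s.

(* The maximal length of an M-regular sequence in the maximal ideal of A. *)
Definition depth (M : lmodType A) (d : nat) : Prop :=
  (exists s : seq A,
     [/\ size s = d, {in s, forall x, nonunits A x} & regular_seq M s]) /\
  (forall s : seq A,
     {in s, forall x, nonunits A x} -> regular_seq M s -> (size s <= d)%N).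

Definition injective_module (E : lmodType A) : Prop :=
  forall (N M : lmodType A) (i : {linear N -> M}) (f : {linear N -> E}),
    injective i -> exists g : {linear M -> E}, forall x, g (i x) = f x.

(* M has an injective resolution of length at most n. *)
Fixpoint inj_dim_le (n : nat) (M : lmodType A) : Prop :=
  if n is n'.+1 then
    exists (E Q : lmodType A) (i : {linear M -> E}) (q : {linear E -> Q}),
      [/\ injective_module E,
          injective i,
          (forall y, q y = 0 <-> exists x, y = i x),
          (forall z, exists y, z = q y)
        & inj_dim_le n' Q]
  else injective_module M.

End Modules.

Definition cohen_macaulay (A : comUnitRingType) : Prop :=
  exists d, krull_dim A d /\ depth A^o d.

Section Germs.
Variable k : fieldType.

Definition has_residue_field (X : comUnitAlgType k) : Prop :=
  forall a : X, exists c : k, nonunits X (a - c%:A).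

(* Local ring of a curve over k at a k-rational point: algebraic, analytic and
   formal germs are all instances. *)
Definition curve_germ (X : comUnitAlgType k) : Prop :=
  [/\ is_local X, has_residue_field X, noetherian X, krull_dim X 1
    & cohen_macaulay X].

(* Ext^1(k, M) is one-dimensional over k. It is computed from the presentation
   0 -> m -> X -> k -> 0 as the cokernel of M = Hom(X, M) -> Hom(m, M);
   a homomorphism m -> M is represented by a map on X that is linear on m. *)
Definition hom_max (X : comUnitAlgType k) (M : lmodType X) (phi : X -> M) :=
  forall a u v, nonunits X u -> nonunits X v ->
    phi (a * u + v) = a *: phi u + phi v.

Definition ext1_residue_dim1 (X : comUnitAlgType k) (M : lmodType X) : Prop :=
  exists phi : X -> M,
    [/\ hom_max phi,
        ~ (exists w : M, forall u, nonunits X u -> phi u = u *: w)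
      & forall psi : X -> M, hom_max psi ->
          exists (c : k) (w : M), forall u, nonunits X u ->
            psi u = (c%:A : X) *: phi u + u *: w].

(* The stalk of the dualising sheaf of a curve, that is the canonical module
   of its Cohen-Macaulay local ring of dimension 1: a maximal Cohen-Macaulay
   module of type 1 and finite injective dimension. *)
Definition dualising_module (X : comUnitAlgType k) (omega : lmodType X) : Prop :=
  [/\ fin_gen omega, depth omega 1, exists n, inj_dim_le n omega
    & ext1_residue_dim1 omega].

Definition gorenstein (X : comUnitAlgType k) : Prop :=
  exists omega : lmodType X, dualising_module omega /\ free_rank1 omega.

(* X = X1 *_k X2 through f1 and f2; the value of x in the residue field k of
   Xi is the c such that x - c is not a unit. *)
Definition glued (X X1 X2 : comUnitAlgType k)
    (f1 : {lrmorphism X -> X1}) (f2 : {lrmorphism X -> X2}) : Prop :=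
  (forall r : X, exists c : k,
     nonunits X1 (f1 r - c%:A) /\ nonunits X2 (f2 r - c%:A)) /\
  (forall (a1 : X1) (a2 : X2),
     (exists c : k, nonunits X1 (a1 - c%:A) /\ nonunits X2 (a2 - c%:A)) ->
     exists! r : X, f1 r = a1 /\ f2 r = a2).

Definition decomposable (X : comUnitAlgType k) : Prop :=
  exists (X1 X2 : comUnitAlgType k)
         (f1 : {lrmorphism X -> X1}) (f2 : {lrmorphism X -> X2}),
    [/\ curve_germ X1, curve_germ X2 & glued f1 f2].

End Germs.

(* The ring k[[x,y]]; [f i j] is the coefficient of x^i y^j. *)
Definition powser2 (k : fieldType) : Type := nat -> nat -> k^o.

Section PowerSeries.
Variable k : fieldType.
Local Notation S := (powser2 k).

HB.instance Definition _ := GRing.Lmodule.copy S (nat -> nat -> k^o).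

Definition ps_one : S := fun i j => ((i == 0) && (j == 0))%N%:R.

Definition ps_mul (f g : S) : S := fun i j =>
  \sum_(a < i.+1) \sum_(b < j.+1) f a b * g (i - a)%N (j - b)%N.

Definition ps_x : S := fun i j => ((i == 1) && (j == 0))%N%:R.
Definition ps_y : S := fun i j => ((i == 0) && (j == 1))%N%:R.

Let trunc (n : nat) (f : S) : {poly {poly k}} :=
  \poly_(i < n) \poly_(j < n) f i j.

Let coef_trunc n f i j : (i < n)%N -> (j < n)%N -> (trunc n f)`_i`_j = f i j.
Proof. by move=> hi hj; rewrite /trunc coef_poly hi coef_poly hj. Qed.

Let coef_mul n (p q : {poly {poly k}}) f g i j :
    (forall a b, (a < n)%N -> (b < n)%N -> p`_a`_b = f a b) ->
    (forall a b, (a < n)%N -> (b < n)%N -> q`_a`_b = g a b) ->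
  (i < n)%N -> (j < n)%N -> (p * q)`_i`_j = ps_mul f g i j.
Proof.
move=> hp hq hi hj; rewrite coefM coef_sum; apply: eq_bigr => a _.
rewrite coefM; apply: eq_bigr => b _.
have ha : (a < n)%N by apply: leq_trans hi; apply: ltn_ord.
have hb : (b < n)%N by apply: leq_trans hj; apply: ltn_ord.
by rewrite hp // hq //; [apply: leq_ltn_trans hi|apply: leq_ltn_trans hj];
  apply: leq_subr.
Qed.

Let coef_mulT n f g i j : (i < n)%N -> (j < n)%N ->
  (trunc n f * trunc n g)`_i`_j = ps_mul f g i j.
Proof. by apply: coef_mul => a b; apply: coef_trunc. Qed.

Let ltmax i j : (i < (maxn i j).+1)%N /\ (j < (maxn i j).+1)%N.
Proof. by rewrite !ltnS leq_maxl leq_maxr. Qed.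

Let ps_mulA : associative ps_mul.
Proof.
move=> f g h; apply/funext => i; apply/funext => j.
have [hi hj] := ltmax i j; set n := (maxn i j).+1 in hi hj.
have tr := @coef_trunc n; have trM := @coef_mulT n.
rewrite -(@coef_mul n (trunc n f) (trunc n g * trunc n h)) //.
- by rewrite mulrA; apply: (@coef_mul n) => // a b; [apply: trM|apply: tr].
- by move=> a b; apply: tr.
- by move=> a b; apply: trM.
Qed.

Let ps_mulC : commutative ps_mul.
Proof.
move=> f g; apply/funext => i; apply/funext => j.
have [hi hj] := ltmax i j.
by rewrite -!(@coef_mulT (maxn i j).+1) // mulrC.
Qed.

Let ps_mul1 : left_id ps_one ps_mul.
Proof.
move=> f; apply/funext => i; apply/funext => j.
rewrite /ps_mul big_ord_recl big_ord_recl /= !subn0 mul1r.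
rewrite !big1 ?addr0 // => a _; last by rewrite mul0r.
by rewrite big1 // => b _; rewrite mul0r.
Qed.

Let ps_mulDl : left_distributive ps_mul +%R.
Proof.
move=> f g h; apply/funext => i; apply/funext => j.
rewrite /ps_mul !fctE -big_split; apply: eq_bigr => a _ /=.
by rewrite -big_split; apply: eq_bigr => b _; rewrite /= mulrDl.
Qed.

Let ps_one_neq0 : ps_one != 0.
Proof.
by apply/eqP => /(congr1 (fun f : S => f 0%N 0%N)) /eqP; rewrite oner_eq0.
Qed.

HB.instance Definition _ := GRing.Zmodule_isComNzRing.Build S
  ps_mulA ps_mulC ps_mul1 ps_mulDl ps_one_neq0.

Let ps_scaleAl (c : k) (f g : S) : c *: (f * g) = (c *: f) * g.
Proof.
apply/funext => i; apply/funext => j.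
transitivity (c * (f * g) i j) => //; rewrite mulr_sumr.
by apply: eq_bigr => a _; rewrite mulr_sumr; apply: eq_bigr => b _; rewrite mulrA.
Qed.

HB.instance Definition _ := GRing.Lmodule_isLalgebra.Build k S ps_scaleAl.
HB.instance Definition _ := GRing.Lalgebra_isComAlgebra.Build k S.

End PowerSeries.

Arguments ps_x {k}.
Arguments ps_y {k}.

Section Node.
Variable k : fieldType.

(* The k-algebra B is the inverse limit of the X / I^n, where pr n represents
   the projection B -> X / I^n. *)
Definition is_adic_completion (X : comUnitAlgType k) (I : set X)
    (B : comAlgType k) (pr : nat -> B -> X) : Prop :=
  let eqmod n (u v : X) := ideal_exp I n (u - v) in
  [/\ forall n, [/\ eqmod n (pr n 1) 1,
        forall a b, eqmod n (pr n (a + b)) (pr n a + pr n b),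
        forall a b, eqmod n (pr n (a * b)) (pr n a * pr n b)
      & forall (c : k) a, eqmod n (pr n (c *: a)) (c *: pr n a)],
      forall n a, eqmod n (pr n.+1 a) (pr n a),
      forall a b, (forall n, eqmod n (pr n a) (pr n b)) -> a = b
    & forall r : nat -> X, (forall n, eqmod n (r n.+1) (r n)) ->
        exists a, forall n, eqmod n (pr n a) (r n)].

(* The completed local ring B of X is isomorphic to k[[x,y]]/(xy), where the
   isomorphism is induced by pi. *)
Definition node (X : comUnitAlgType k) : Prop :=
  exists (B : comAlgType k) (pr : nat -> B -> X)
         (pi : {lrmorphism powser2 k -> B}),
    [/\ is_adic_completion (nonunits X) pr,
        forall b, exists f, b = pi f
      & forall f, pi f = 0 <-> exists g, f = ps_x * ps_y * g].

End Node.

(* Main.v *)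
Require Import Defs.
From mathcomp Require Import all_boot all_algebra reals.
From HB Require Import structures.
From mathcomp Require Import boolp classical_sets functions.
From mathcomp Require Import generic_quotient ring_quotient.

(* Write m, m1, m2 for the maximal ideals of X, X1, X2, so that m is the direct
   sum of m1 and m2. Gorenstein means that Ext^1(k, X) = Hom(m, X) / X is a
   line. The projection of m to m1 is not a multiplication, since each mi
   contains a nonzerodivisor and X is local; so it spans this line, which
   forces End(mi) = Xi. As Xi has depth one, this makes mi principal, generated
   by a nonzerodivisor ti. Then X / m^n is the fibre product of the
   truncated polynomial rings in t1 and t2, and the completion of X is
   k[[x,y]]/(xy). *)

Set Implicit Arguments.
Unset Strict Implicit.
Unset Printing Implicit Defensive.

Import GRing.Theory.
Local Open Scope quotient_scope.
Local Open Scope classical_set_scope.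
Local Open Scope ring_scope.

Section IdealTheory.
Variable A : comPzRingType.
Implicit Types (I J : set A).

Lemma idealD I u v : is_ideal I -> I u -> I v -> I (u + v).
Proof. by move=> [_ h] hu hv; rewrite -[u]mul1r; apply: h. Qed.

Lemma idealM I a u : is_ideal I -> I u -> I (a * u).
Proof. by move=> [h0 h] hu; rewrite -[_ * _]addr0; apply: h. Qed.

Lemma idealN I u : is_ideal I -> I u -> I (- u).
Proof. by move=> hI hu; rewrite -mulN1r; apply: idealM. Qed.

Lemma idealB I u v : is_ideal I -> I u -> I v -> I (u - v).
Proof. by move=> hI hu hv; apply: idealD => //; apply: idealN. Qed.

Lemma sub_ideal_gen (S : set A) : S `<=` ideal_gen S.
Proof. by move=> x Sx J _; apply. Qed.

Lemma ideal_gen_sub (S J : set A) :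
  is_ideal J -> S `<=` J -> ideal_gen S `<=` J.
Proof. by move=> hJ SJ x; apply. Qed.

Lemma noetherian_max (F : set (set A)) I0 : noetherian A ->
  (forall I, F I -> is_ideal I) -> F I0 ->
  exists2 I, F I & forall J, F J -> I `<=` J -> J = I.
Proof.
move=> nA FI FI0; apply: contrapT => nomax.
have next (I : {I | F I}) : {J : {J | F J} | projT1 I `<` projT1 J}.
  apply: cid; case: I => I FII /=; apply: contrapT => nJ; apply: nomax.
  exists I => // J FJ IJ; apply: contrapT => JI; apply: nJ.
  exists (exist _ J FJ) => /=; split=> // JsubI.
  by apply: JI; apply/seteqP.
pose c := fix c n := if n is n'.+1 then projT1 (next (c n'))
                     else exist F I0 FI0.
have cS n : projT1 (c n) `<` projT1 (c n.+1) := projT2 (next (c n)).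
have cle m n : (m <= n)%N -> projT1 (c m) `<=` projT1 (c n).
  move=> /subnK <-; elim: (n - m)%N => // d ih.
  by apply: subset_trans ih _; case: (cS (d + m)%N).
have ci n : is_ideal (projT1 (c n)) := FI _ (projT2 (c n)).
pose U := \bigcup_n projT1 (c n).
have iU : is_ideal U.
  split; first by exists 0%N => //; case: (ci 0%N).
  move=> a u v [m _ hu] [n _ hv]; exists (maxn m n) => //.
  apply: (ci _).2; first exact: cle (leq_maxl _ _) _ hu.
  exact: cle (leq_maxr _ _) _ hv.
have [n [g gU]] := nA _ iU.
have /choice [h hh] : forall i : 'I_n, exists m, projT1 (c m) (g i).
  move=> i; have : U (g i) by rewrite gU; apply: sub_ideal_gen; exists i.
  by case=> m _ hm; exists m.
pose N := \max_i h i.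
case: (cS N) => _; apply.
have NU : projT1 (c N.+1) `<=` U by move=> x hx; exists N.+1.
apply: subset_trans NU _; rewrite gU; apply: ideal_gen_sub => // _ [i _ <-].
exact: cle (leq_bigmax i) _ (hh i).
Qed.

Lemma noetherian_prime_avoiding (S : set A) : noetherian A -> S 1 -> ~ S 0 ->
  (forall u v, S u -> S v -> S (u * v)) ->
  exists2 P, is_prime P & forall u, P u -> ~ S u.
Proof.
move=> nA S1 S0 SM.
have [||P [iP PS] maxP] := @noetherian_max
    [set I | is_ideal I /\ forall u, I u -> ~ S u] [set 0] nA.
- by move=> I [].
- by split=> [|_ -> //]; split=> // a _ _ -> ->; rewrite mulr0 addr0.
exists P => //; split=> //; first by move=> /PS.
pose I w : set A := [set x | exists2 p, P p & exists b, x = p + b * w].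
have iI w : is_ideal (I w).
  split; first by exists 0; [case: iP | exists 0; rewrite mul0r addr0].
  move=> a _ _ [p Pp [b ->]] [q Pq [c ->]].
  exists (a * p + q); first exact: iP.2.
  by exists (a * b + c); rewrite mulrDr mulrDl addrACA mulrA.
have meet w : ~ P w -> exists2 s, I w s & S s.
  move=> Pw; apply: contrapT => nS; apply: Pw.
  rewrite -(maxP (I w)).
  - by exists 0; [case: iP | exists 1; rewrite mul1r add0r].
  - by split=> // u Iu Su; apply: nS; exists u.
  - by move=> p Pp; exists p => //; exists 0; rewrite mul0r addr0.
move=> u v Puv; apply: contrapT => /not_orP[/meet[s [p Pp [b ->]] Ss]].
move=> /meet[t [q Pq [c ->]] St]; apply: PS (SM _ _ Ss St).
rewrite mulrDl; apply: idealD => //; first by rewrite mulrC; apply: idealM.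
rewrite mulrDr; apply: idealD => //; first exact: idealM.
by rewrite mulrACA; apply: idealM.
Qed.

End IdealTheory.

Section LocalRing.
Variable A : comUnitRingType.
Hypothesis locA : is_local A.

Lemma nonunitM (a u : A) : nonunits A u -> nonunits A (a * u).
Proof. exact: idealM. Qed.

Lemma nonunits_prime : is_prime (nonunits A).
Proof.
split=> //; first by rewrite /nonunits /= unitr1.
move=> u v; rewrite /nonunits /= unitrM negb_and => /orP[]; first by left.
by right.
Qed.

Lemma prime_nonunits (P : set A) : is_prime P -> P `<=` nonunits A.
Proof.
move=> [iP P1 _] x Px; apply/negP => xU; apply: P1.
by rewrite -(mulVr xU); apply: idealM.
Qed.

Definition regular (x : A) := forall v, x * v = 0 -> v = 0.

Lemma regular_mulI x u v : regular x -> x * u = x * v -> u = v.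
Proof.
move=> rx /eqP; rewrite -subr_eq0 -mulrBr => /eqP /rx /eqP.
by rewrite subr_eq0 => /eqP.
Qed.

(* A prime P containing a regular element is never minimal: the prime avoiding
   the products [x ^+ n * s] with [s] outside P lies strictly below P. *)
Lemma prime_regular_max (x : A) (P : set A) : noetherian A -> krull_dim A 1 ->
  regular x -> is_prime P -> P x -> P = nonunits A.
Proof.
move=> nA [_ dimA] rx pP Px; have [iP P1 PM] := pP.
have [|[n [s [Ps]]]||Q pQ QS] := @noetherian_prime_avoiding _
    [set y | exists n s, ~ P s /\ y = x ^+ n * s] nA.
- by exists 0%N, 1; rewrite mulr1.
- elim: n => [|n ih].
    by rewrite mul1r => s0; apply: Ps; rewrite -s0; case: iP.
  by rewrite exprS -mulrA => /esym/rx/esym.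
- move=> _ _ [m [s [Ps ->]]] [n [t [Pt ->]]]; exists (m + n)%N, (s * t).
  by split; [case/PM | rewrite exprD mulrACA].
have QP : Q `<` P.
  split; last first.
    by move=> PQ; apply: (QS x); [apply: PQ | exists 1%N, 1; rewrite mulr1].
  move=> u Qu; apply: contrapT => Pu; apply: QS Qu _.
  by exists 0%N, u; rewrite mul1r.
apply/seteqP; split; first exact: prime_nonunits.
apply: contrapT => mP.
have := dimA 2%N (fun n => if n is n'.+1 then
                             if n' is _.+1 then nonunits A else P else Q).
case/(_ _)/negP => //; split=> [[|[|n]]|[|[|]]] //= _.
  exact: nonunits_prime.
by split=> //; apply: prime_nonunits.
Qed.

Lemma regular_socle (x : A) : noetherian A -> krull_dim A 1 ->
  regular x -> nonunits A x ->
  exists y, (forall a, y <> a * x) /\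
    forall u, nonunits A u -> exists a, u * y = a * x.
Proof.
move=> nA dimA rx xN.
pose ann y := [set u : A | exists a, u * y = a * x].
have iann y : is_ideal (ann y).
  split; first by exists 0; rewrite !mul0r.
  move=> a u v [b hb] [c hc]; exists (a * b + c).
  by rewrite !mulrDl -!mulrA hb hc.
have [||_ [y yx <-] maxP] := @noetherian_max _
    [set I | exists2 y, (forall a, y <> a * x) & ann y = I] (ann 1) nA.
- by move=> _ [y _ <-].
- exists 1 => // a h; case/negP: xN; apply/unitrPr; exists a.
  by rewrite mulrC.
exists y; split=> //; rewrite -[forall u, _]/(nonunits A `<=` ann y).
rewrite -(@prime_regular_max x (ann y)) //; last by exists y; rewrite mulrC.
split=> //; first by move=> [a]; rewrite mul1r => /yx.
move=> u v [a h]; apply: contrapT => /not_orP[hu hv]; apply: hu.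
rewrite -(maxP (ann (v * y))); first by exists a; rewrite mulrA.
  by exists (v * y) => // b hb; apply: hv; exists b.
by move=> w [b hb]; exists (v * b); rewrite mulrCA hb mulrA.
Qed.

End LocalRing.

Section CurveGerm.
Variables (k : fieldType) (X : comUnitAlgType k).

Lemma curve_germ_regular : curve_germ X ->
  exists2 x : X, nonunits X x & regular x.
Proof.
move=> [_ _ _ dimX [d [dimd [[s [sd sN sreg]] _]]]].
have d1 : d = 1%N.
  apply/eqP; rewrite eqn_leq.
  have [[P cP] hP] := dimd; have [[Q cQ] hQ] := dimX.
  by rewrite (hQ _ _ cP) (hP _ _ cQ).
case: s sd sN sreg => [|x s]; rewrite d1 // => _ sN [rx _].
by exists x; [apply: sN; rewrite inE eqxx | move=> v; apply: rx].
Qed.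

(* If the maximal ideal m is not principal, every map m -> X lands in m, so
   End(m) = X gives Hom(m, X) = X; but multiplication by y / x, with y a socle
   element modulo x, is not a multiplication. *)
Lemma nonunits_principal : curve_germ X ->
  (forall phi : X -> X^o, hom_max phi ->
     (forall u, nonunits X u -> nonunits X (phi u)) ->
     exists w : X, forall u, nonunits X u -> phi u = u * w) ->
  exists t : X, [/\ nonunits X t, regular t &
    forall u, nonunits X u -> exists a, u = a * t].
Proof.
move=> gX endm; have [x xN rx] := curve_germ_regular gX.
have [locX _ nX dimX _] := gX.
have [y [yx /= ym]] := regular_socle locX nX dimX rx xN.
have /choice[phi hphi] : forall u, exists a, nonunits X u -> u * y = a * x.
  move=> u; have [/ym[a ha]|nu] := pselect (nonunits X u); first by exists a.
  by exists 0.
have homphi : hom_max (phi : X -> X^o).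
  move=> a u v uN vN; apply: (regular_mulI rx).
  rewrite ![x * _]mulrC -hphi; last by apply: locX.2.
  by rewrite !mulrDl -!mulrA !hphi // mulrA.
have [t [tN tU]] : exists t, nonunits X t /\ phi t \is a GRing.unit.
  apply: contrapT => nt; have [|w hw] := endm _ homphi.
    by move=> u uN; apply/negP => hu; apply: nt; exists u.
  apply: (yx w); apply: (regular_mulI rx).
  by rewrite hphi // hw // mulrC [w * x]mulrC.
have tP u : nonunits X u -> exists a, u = a * t.
  move=> uN; exists (phi u / phi t).
  rewrite mulrAC; apply: (canRL (mulrK tU)); apply: (regular_mulI rx).
  rewrite mulrCA [x * phi t]mulrC -hphi // mulrCA hphi // mulrA mulrC.
  by rewrite [t * _]mulrC.
exists t; split=> // v tv; have [a xa] := tP x xN.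
by apply: rx; rewrite xa -mulrA tv mulr0.
Qed.

End CurveGerm.

Lemma ext1_residue_dim1_free (k : fieldType) (X : comUnitAlgType k)
    (M : lmodType X) :
  free_rank1 M -> ext1_residue_dim1 M -> ext1_residue_dim1 X^o.
Proof.
move=> [e he] [phi [homphi nphi gen]].
have inje (a b : X) : a *: e = b *: e -> a = b.
  by case: (he (a *: e)) => c [_ uc] ab; rewrite -(uc a) // (uc b).
have /choice[g ge] : forall v, exists a : X, v = a *: e.
  by move=> v; case: (he v) => a [ha _]; exists a.
exists (g \o phi : X -> X^o); split=> /= [a u v uN vN|[w hw]|psi hpsi].
- by apply: inje; rewrite scalerDl -scalerA -!ge homphi.
- apply: nphi; exists (w *: e) => u uN.
  by rewrite [LHS]ge hw // scalerA.
- have [|c [w hw]] := gen (fun u => (psi u : X) *: e).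
    by move=> a u v uN vN; rewrite hpsi // scalerDl -scalerA.
  exists c, (g w) => u uN; apply: inje.
  by rewrite hw // scalerDl -!scalerA -!ge.
Qed.

Section Glued.
Variables (k : fieldType) (X X1 X2 : comUnitAlgType k).
Variables (f1 : {lrmorphism X -> X1}) (f2 : {lrmorphism X -> X2}).
Hypothesis glueX : glued f1 f2.

Lemma glued_sym : glued f2 f1.
Proof.
case: glueX => res ex; split.
  by move=> r; have [c [h1 h2]] := res r; exists c.
move=> a2 a1 [c [h2 h1]]; have [|r [[e1 e2] ur]] := ex a1 a2; first by exists c.
by exists r; split=> // s [s1 s2]; apply: ur.
Qed.

Lemma glued_inj r s : f1 r = f1 s -> f2 r = f2 s -> r = s.
Proof.
case: glueX => res ex e1 e2; have [q [_ uq]] := ex _ _ (res s).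
by rewrite -(uq r) ?(uq s).
Qed.

Hypotheses (loc1 : is_local X1) (loc2 : is_local X2).

Lemma glued_lift1 u : nonunits X1 u -> exists r, f1 r = u /\ f2 r = 0.
Proof.
move=> uN; have [|r [hr _]] := glueX.2 u 0; last by exists r.
by exists 0; rewrite !scale0r !subr0; split=> //; exact: loc2.1.
Qed.

Lemma glued_lift2 u : nonunits X2 u -> exists r, f1 r = 0 /\ f2 r = u.
Proof.
move=> uN; have [|r [hr _]] := glueX.2 0 u; last by exists r.
by exists 0; rewrite !scale0r !subr0; split=> //; exact: loc1.1.
Qed.

Lemma glued_unit1 r : f1 r \is a GRing.unit -> r \is a GRing.unit.
Proof.
move=> u1; have [c [h1 h2]] := glueX.1 r.
have cN0 : c != 0.
  apply/eqP => c0; move: h1; rewrite c0 scale0r subr0 /nonunits /=.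
  by rewrite u1.
have cU (Y : comUnitAlgType k) : c%:A \is a @GRing.unit Y.
  by rewrite -in_algE rmorph_unit // unitfE.
have cV (Y : comUnitAlgType k) : c%:A^-1 = c^-1%:A :> Y.
  by rewrite -!in_algE fmorphV.
have u2 : f2 r \is a GRing.unit.
  apply: contrapT => /negP n2; have [] := negP n2.
  have : nonunits X2 (c%:A) by rewrite -[c%:A](subKr (f2 r)); apply: idealB.
  by rewrite /nonunits /= cU.
have res (Y : comUnitAlgType k) (y : Y) : is_local Y -> y \is a GRing.unit ->
    nonunits Y (y - c%:A) -> nonunits Y (y^-1 - c^-1%:A).
  move=> locY yU yN.
  have -> : y^-1 - c^-1%:A = - (y^-1 * c%:A^-1) * (y - c%:A).
    rewrite -cV mulrBr !mulNr opprK mulrAC mulVr // mul1r -mulrA mulVr ?cU //.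
    by rewrite mulr1 addrC.
  exact: (nonunitM locY).
have [|s [[s1 s2] _]] := glueX.2 (f1 r)^-1 (f2 r)^-1.
  by exists c^-1; split; apply: res.
apply/unitrPr; exists s.
by apply: glued_inj; rewrite rmorphM rmorph1 /= ?s1 ?s2 mulrV.
Qed.

Lemma glued_nonunits1 r : nonunits X r <-> nonunits X1 (f1 r).
Proof.
split; apply: contraNN; first exact: glued_unit1.
exact: rmorph_unit.
Qed.

End Glued.

Lemma glued_nonunits2 (k : fieldType) (X X1 X2 : comUnitAlgType k)
    (f1 : {lrmorphism X -> X1}) (f2 : {lrmorphism X -> X2}) r :
  glued f1 f2 -> is_local X1 -> is_local X2 ->
  nonunits X r <-> nonunits X2 (f2 r).
Proof.
by move=> glueX loc1 loc2; apply: (glued_nonunits1 (glued_sym glueX)).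
Qed.

Section GluedGorenstein.
Variables (k : fieldType) (X X1 X2 : comUnitAlgType k).
Variables (f1 : {lrmorphism X -> X1}) (f2 : {lrmorphism X -> X2}).
Hypotheses (glueX : glued f1 f2).
Hypotheses (germ1 : curve_germ X1) (germ2 : curve_germ X2).

Let loc1 : is_local X1. Proof. by case: germ1. Qed.
Let loc2 : is_local X2. Proof. by case: germ2. Qed.

(* The maximal ideal of X is the direct sum of those of X1 and X2. Projection
   to the first summand is not a multiplication, so it spans the
   one-dimensional Ext^1(k, X); hence every endomorphism of the first summand
   is a multiplication. *)
Lemma glued_gorenstein_principal : ext1_residue_dim1 X^o ->
  exists t : X1, [/\ nonunits X1 t, regular t &
    forall u, nonunits X1 u -> exists a, u = a * t].
Proof.
move=> [phi [homphi nphi gen]].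
have /choice[j jP] : forall u : X1, exists r : X,
    nonunits X1 u -> f1 r = u /\ f2 r = 0.
  move=> u; have [uN|uU] := pselect (nonunits X1 u); last by exists 0.
  by have [r hr] := glued_lift1 glueX loc2 uN; exists r.
have N1 r : nonunits X r -> nonunits X1 (f1 r).
  by move=> h; apply/(glued_nonunits1 glueX loc1 loc2).
have homj (psi : X1 -> X1) : hom_max (psi : X1 -> X1^o) ->
    (forall u, nonunits X1 u -> nonunits X1 (psi u)) ->
    hom_max (fun r => j (psi (f1 r)) : X^o).
  move=> hpsi psiN a u v uN vN.
  have [uN1 vN1] : nonunits X1 (f1 u) /\ nonunits X1 (f1 v) by split; apply: N1.
  suff: j (psi (f1 (a * u + v))) = a * j (psi (f1 u)) + j (psi (f1 v)) by [].
  have [|e1 e2] := jP (psi (f1 (a * u + v))).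
    by apply: psiN; rewrite rmorphD rmorphM /=; apply: loc1.2.
  have [pu pv] := (psiN _ uN1, psiN _ vN1).
  apply: (glued_inj glueX).
    by rewrite e1 !rmorphD !rmorphM /= hpsi // !(jP _ _).1.
  by rewrite e2 !rmorphD !rmorphM /= !(jP _ _).2 // mulr0 addr0.
have [c0 [w0 h0]] := gen _ (homj id (fun _ _ _ _ _ => erefl) (fun _ => id)).
have c0N : c0 != 0.
  apply/eqP => c00; have [x1 x1N r1] := curve_germ_regular germ1.
  have [x2 x2N r2] := curve_germ_regular germ2.
  have mw r : nonunits X r -> j (f1 r) = r * w0.
    by move=> rN; rewrite h0 // c00 scale0r scale0r add0r.
  have w1 : f1 w0 = 1.
    have [s [s1 s2]] := glued_lift1 glueX loc2 x1N.
    have sN : nonunits X s.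
      by apply/(glued_nonunits1 glueX loc1 loc2); rewrite s1.
    apply: (regular_mulI r1); rewrite mulr1.
    by have := congr1 f1 (mw s sN); rewrite rmorphM /= (jP _ _).1 s1.
  have w2 : f2 w0 = 0.
    have [s [s1 s2]] := glued_lift2 glueX loc1 x2N.
    have sN : nonunits X s.
      by apply/(glued_nonunits2 _ glueX loc1 loc2); rewrite s2.
    apply: (regular_mulI r2); rewrite mulr0.
    have := congr1 f2 (mw s sN); rewrite rmorphM /= (jP _ _).2 ?s2 // s1.
    by case: loc1.
  have : nonunits X w0.
    by apply/(glued_nonunits2 _ glueX loc1 loc2); rewrite w2; case: loc2.
  by move=> /N1; rewrite /nonunits /= w1 unitr1.
apply: nonunits_principal => // psi hpsi psiN.
have [c [w hw]] := gen _ (homj psi hpsi psiN).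
exists ((c / c0)%:A * (1 - f1 w0) + f1 w) => u uN.
have [s [s1 s2]] := glued_lift1 glueX loc2 uN.
have sN : nonunits X s by apply/(glued_nonunits1 glueX loc1 loc2); rewrite s1.
have es : s = c0%:A * (phi s : X) + s * w0.
  rewrite -[LHS](_ : j u = s); last first.
    by apply: (glued_inj glueX); rewrite ?(jP _ uN).1 ?(jP _ uN).2.
  by rewrite -[in LHS]s1; apply: h0.
have := congr1 f1 (hw s sN); rewrite s1 (jP _ (psiN _ uN)).1 => ->.
have := congr1 f1 es; rewrite !rmorphD !rmorphM /= s1 !rmorph_alg => eu.
rewrite mulrDr; congr (_ + _); rewrite mulrCA mulrBr mulr1 {1}eu addrK.
by rewrite mulrA -!in_algE -rmorphM /= divfK.
Qed.

End GluedGorenstein.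

Section CrossRing.
Variable k : fieldType.
Local Notation S := (powser2 k).

(* This is the ideal (xy): see [to_cross_eq0]. *)
Definition vanish_axes : pred S :=
  [pred f : S | `[< forall n, f n 0%N = 0 /\ f 0%N n = 0 >]].

Lemma psM_axis1 (f g : S) n :
  (f * g) n 0%N =
    \sum_(a < n.+1) (f a 0%N : k) * (g (n - a)%N 0%N : k) :> k.
Proof. by apply: eq_bigr => a _; rewrite big_ord1. Qed.

Lemma psM_axis2 (f g : S) n :
  (f * g) 0%N n =
    \sum_(b < n.+1) (f 0%N b : k) * (g 0%N (n - b)%N : k) :> k.
Proof. by rewrite [LHS]big_ord1. Qed.

Lemma vanish_axes_idealr : idealr_closed vanish_axes.
Proof.
split=> [||a u v].
- by apply/asboolP.
- by apply/asboolP => /(_ 0%N)[/eqP]; rewrite oner_eq0.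
- move=> /asboolP hu /asboolP hv; apply/asboolP => n; split.
    rewrite [LHS](_ : _ = (a * u) n 0%N + v n 0%N) // psM_axis1 (hv n).1 addr0.
    by rewrite big1 // => i _; rewrite (hu _).1 mulr0.
  rewrite [LHS](_ : _ = (a * u) 0%N n + v 0%N n) // psM_axis2 (hv n).2 addr0.
  by rewrite big1 // => i _; rewrite (hu _).2 mulr0.
Qed.

HB.instance Definition _ := isIdealr.Build S vanish_axes vanish_axes_idealr.

Definition axes_ideal : idealr S := vanish_axes.

Definition cross_ring := {ideal_quot axes_ideal}.

HB.instance Definition _ := GRing.ComNzRing.on cross_ring.

Definition to_cross (f : S) : cross_ring := \pi_({ideal_quot axes_ideal}) f.

Lemma to_cross_zmod : zmod_morphism to_cross.
Proof. exact: rmorphB. Qed.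

Lemma to_cross_monoid : monoid_morphism to_cross.
Proof. by split; [apply: rmorph1 | apply: rmorphM]. Qed.

HB.instance Definition _ :=
  GRing.isZmodMorphism.Build S cross_ring to_cross to_cross_zmod.
HB.instance Definition _ :=
  GRing.isMonoidMorphism.Build S cross_ring to_cross to_cross_monoid.

Definition cross_scale (c : k) (b : cross_ring) : cross_ring :=
  to_cross c%:A * b.

Lemma cross_scaleA c d b :
  cross_scale c (cross_scale d b) = cross_scale (c * d) b.
Proof.
by rewrite /cross_scale mulrA -rmorphM /= -!in_algE -rmorphM.
Qed.

Lemma cross_scale1 : left_id 1 cross_scale.
Proof. by move=> b; rewrite /cross_scale scale1r rmorph1 mul1r. Qed.

Lemma cross_scaleDr : right_distributive cross_scale +%R.
Proof. by move=> c a b; rewrite /cross_scale mulrDr. Qed.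

Lemma cross_scaleDl b : {morph cross_scale^~ b : c d / c + d}.
Proof. by move=> c d; rewrite /cross_scale scalerDl rmorphD mulrDl. Qed.

HB.instance Definition _ := GRing.Zmodule_isLmodule.Build k cross_ring
  cross_scaleA cross_scale1 cross_scaleDr cross_scaleDl.

Lemma cross_scaleAl (c : k) (a b : cross_ring) : c *: (a * b) = (c *: a) * b.
Proof. exact: mulrA. Qed.

HB.instance Definition _ :=
  GRing.Lmodule_isLalgebra.Build k cross_ring cross_scaleAl.
HB.instance Definition _ := GRing.Lalgebra_isComAlgebra.Build k cross_ring.

Lemma to_cross_scalable : scalable to_cross.
Proof. by move=> c f; rewrite -mulr_algl rmorphM. Qed.

HB.instance Definition _ :=
  GRing.isScalable.Build k S cross_ring *:%R to_cross to_cross_scalable.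

Lemma to_cross_surj b : exists f, b = to_cross f.
Proof. by exists (repr b); rewrite /to_cross reprK. Qed.

Lemma to_crossP f g : to_cross f = to_cross g <->
  forall n, f n 0%N = g n 0%N /\ f 0%N n = g 0%N n.
Proof.
have -> : (to_cross f = to_cross g) <-> (f - g \in axes_ideal).
  by rewrite Quotient.idealrBE; split=> [/eqP|/eqP].
split=> [/asboolP h n|h].
  by have [/eqP h1 /eqP h2] := h n; split; apply/eqP; rewrite -subr_eq0.
apply/asboolP => n; have [h1 h2] := h n.
by split; apply/eqP; rewrite subr_eq0; apply/eqP.
Qed.

End CrossRing.

Lemma ps_xM (k : fieldType) (f : powser2 k) i j :
  (ps_x * f) i j = if i is i'.+1 then f i' j else 0.
Proof.
rewrite [LHS](_ : _ = \sum_(a < i.+1) \sum_(b < j.+1)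
  ps_x a b * f (i - a)%N (j - b)%N) //.
have x0 a b : a != 1%N -> @ps_x k a b = 0 by rewrite /ps_x => /negbTE->.
case: i => [|i].
  by rewrite big_ord1 big1 // => b _; rewrite x0 ?mul0r.
rewrite big_ord_recl big1 => [|b _]; last by rewrite x0 ?mul0r.
rewrite big_ord_recl add0r addrC big1 => [|a _]; last first.
  by rewrite big1 // => b _; rewrite x0 ?mul0r.
rewrite add0r big_ord_recl big1 => [|b _]; last by rewrite /ps_x /= mul0r.
by rewrite /ps_x /= mul1r addr0 /bump /= subSS !subn0.
Qed.

Lemma ps_yM (k : fieldType) (f : powser2 k) i j :
  (ps_y * f) i j = if j is j'.+1 then f i j' else 0.
Proof.
rewrite [LHS](_ : _ = \sum_(a < i.+1) \sum_(b < j.+1)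
  ps_y a b * f (i - a)%N (j - b)%N) //.
rewrite big_ord_recl [X in _ + X]big1 ?addr0 => [|a _]; last first.
  by rewrite big1 // => b _; rewrite /ps_y /= mul0r.
case: j => [|j]; first by rewrite big_ord1 /ps_y /= mul0r.
rewrite !big_ord_recl big1 => [|b _]; last by rewrite /ps_y /= mul0r.
by rewrite /ps_y /= mul0r mul1r add0r addr0 /bump /= subSS !subn0.
Qed.

Lemma to_cross_eq0 (k : fieldType) (f : powser2 k) :
  to_cross f = 0 <-> exists g, f = ps_x * ps_y * g.
Proof.
rewrite -[0](rmorph0 (@to_cross k)) to_crossP.
split=> [f0|[g ->] n]; last first.
  by rewrite -mulrA !ps_xM; split=> //; case: n => // n; rewrite ps_yM.
exists (fun i j => f i.+1 j.+1); apply/funext => i; apply/funext => j.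
rewrite -mulrA ps_xM; case: i => [|i]; first by rewrite (f0 j).2.
by rewrite ps_yM; case: j => // ; rewrite (f0 i.+1).1.
Qed.

Section Uniformizer.
Variables (k : fieldType) (Y : comUnitAlgType k) (t : Y).
Hypotheses (tN : nonunits Y t) (rt : regular t) (locY : is_local Y).
Hypothesis tP : forall u, nonunits Y u -> exists a, u = a * t.

Definition dvdpow n (y : Y) := exists a, y = a * t ^+ n.

Lemma dvdpowD n y z : dvdpow n y -> dvdpow n z -> dvdpow n (y + z).
Proof. by move=> [a ->] [b ->]; exists (a + b); rewrite mulrDl. Qed.

Lemma dvdpowM n a y : dvdpow n y -> dvdpow n (a * y).
Proof. by move=> [b ->]; exists (a * b); rewrite mulrA. Qed.

Lemma dvdpowN n y : dvdpow n y -> dvdpow n (- y).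
Proof. by rewrite -mulN1r; apply: dvdpowM. Qed.

Lemma dvdpowB n y z : dvdpow n y -> dvdpow n z -> dvdpow n (y - z).
Proof. by move=> hy /dvdpowN; apply: dvdpowD. Qed.

Lemma nonunits_alg (c : k) : nonunits Y c%:A -> c = 0.
Proof.
move=> cN; apply/eqP; apply: contraPT cN => c0; apply/negP; rewrite negbK.
by rewrite -in_algE rmorph_unit // unitfE.
Qed.

Lemma dvdpow_horner n (p : {poly k}) :
  dvdpow n (horner_alg t p) <-> forall i, (i < n)%N -> p`_i = 0.
Proof.
split; last first.
  move=> p0; exists (horner_alg t (drop_poly n p)).
  rewrite -{1}(poly_take_drop n p) (_ : take_poly n p = 0) ?add0r; last first.
    by apply/polyP => i; rewrite coef_take_poly coef0; case: ifP => // /p0.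
  by rewrite rmorphM rmorphXn /= horner_algX.
elim: n p => // n ih p [a ha].
have pE : horner_alg t p = (p`_0)%:A + horner_alg t (drop_poly 1 p) * t.
  rewrite -{1}(poly_take_drop 1 p) rmorphD rmorphM /= horner_algX.
  congr (_ + _); rewrite (_ : take_poly 1 p = (p`_0)%:P) ?horner_algC //.
  by apply/polyP => i; rewrite coef_take_poly coefC; case: i.
have p0 : p`_0 = 0.
  apply: nonunits_alg; have -> : (p`_0)%:A =
      (a * t ^+ n - horner_alg t (drop_poly 1 p)) * t.
    by rewrite mulrBl -mulrA -exprSr -ha pE addrK.
  exact: (nonunitM locY).
have dq : dvdpow n (horner_alg t (drop_poly 1 p)).
  exists a; apply: (regular_mulI rt).
  by rewrite mulrC mulrCA -exprS -ha pE p0 scale0r add0r.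
case=> [//|i]; rewrite ltnS => /(ih _ dq).
by rewrite coef_drop_poly addn1.
Qed.

Lemma dvdpow_hornerB n (p q : {poly k}) :
  dvdpow n (horner_alg t p - horner_alg t q) <->
  forall i, (i < n)%N -> p`_i = q`_i.
Proof.
rewrite -rmorphB /= dvdpow_horner; split=> h i /h; rewrite coefB.
  by move/eqP; rewrite subr_eq0 => /eqP.
by move->; rewrite subrr.
Qed.

Lemma horner_approx n (y : Y) : has_residue_field Y ->
  exists p : {poly k}, dvdpow n (horner_alg t p - y).
Proof.
move=> resY; elim: n => [|n [p [a ha]]].
  by exists 0; exists (horner_alg t 0 - y); rewrite mulr1.
have [c /tP[b hb]] := resY a; exists (p - c *: 'X^n); exists b.
rewrite rmorphB /= linearZ /= rmorphXn /= horner_algX addrAC ha.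
rewrite -mulr_algl -mulrBl.
by rewrite mulr1 hb exprS mulrA.
Qed.

Lemma dvdpow1 y : dvdpow 1 y <-> nonunits Y y.
Proof.
split=> [[a ->]|/tP[a ->]]; first exact: (nonunitM locY).
by exists a.
Qed.

End Uniformizer.

Section GluedNode.
Variables (k : fieldType) (X X1 X2 : comUnitAlgType k).
Variables (f1 : {lrmorphism X -> X1}) (f2 : {lrmorphism X -> X2}).
Hypotheses (glueX : glued f1 f2) (loc1 : is_local X1) (loc2 : is_local X2).
Hypotheses (res1 : has_residue_field X1) (res2 : has_residue_field X2).
Variables (t1 : X1) (t2 : X2).
Hypotheses (t1N : nonunits X1 t1) (t2N : nonunits X2 t2).
Hypotheses (rt1 : regular t1) (rt2 : regular t2).
Hypothesis t1P : forall u, nonunits X1 u -> exists a, u = a * t1.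
Hypothesis t2P : forall u, nonunits X2 u -> exists a, u = a * t2.

Lemma glued_surj1 a : exists r, f1 r = a.
Proof.
have [c ac] := res1 a; have [r [r1 _]] := glued_lift1 glueX loc2 ac.
by exists (r + c%:A); rewrite rmorphD /= r1 rmorph_alg subrK.
Qed.

Lemma glued_surj2 a : exists r, f2 r = a.
Proof.
have [c ac] := res2 a; have [r [_ r2]] := glued_lift2 glueX loc1 ac.
by exists (r + c%:A); rewrite rmorphD /= r2 rmorph_alg subrK.
Qed.

Lemma glued_idealP n u : ideal_exp (nonunits X) n u <->
  dvdpow t1 n (f1 u) /\ dvdpow t2 n (f2 u).
Proof.
have N1 r : nonunits X r -> nonunits X1 (f1 r).
  by move=> h; apply/(glued_nonunits1 glueX loc1 loc2).
have N2 r : nonunits X r -> nonunits X2 (f2 r).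
  by move=> h; apply/(glued_nonunits2 _ glueX loc1 loc2).
split=> [|[[a ha] [b hb]]].
  elim: n u => [|n ih] u /=.
    by move=> _; split; [exists (f1 u) | exists (f2 u)]; rewrite mulr1.
  apply: (@ideal_gen_sub _ _
    [set u | dvdpow t1 n.+1 (f1 u) /\ dvdpow t2 n.+1 (f2 u)]).
    split; first by rewrite /= !rmorph0; split; exists 0; rewrite mul0r.
    move=> c v w [v1 v2] [w1 w2] /=; rewrite !rmorphD !rmorphM /=.
    by split; apply: dvdpowD => //; apply: dvdpowM.
  move=> _ [v [w [vN /ih[[a ha] [b hb]] ->]]] /=; rewrite !rmorphM /= ha hb.
  have [c ->] := t1P (N1 _ vN); have [d ->] := t2P (N2 _ vN).
  by split; [exists (c * a) | exists (d * b)]; rewrite mulrACA -exprS.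
case: n ha hb => // n ha hb.
have [x [x1 x2]] := glued_lift1 glueX loc2 t1N.
have [y [y1 y2]] := glued_lift2 glueX loc1 t2N.
have [r r1] := glued_surj1 a; have [s s2] := glued_surj2 b.
have -> : u = r * x ^+ n.+1 + s * y ^+ n.+1.
  apply: (glued_inj glueX).
    by rewrite rmorphD !rmorphM /= !rmorphXn /= x1 y1 r1 expr0n mulr0 addr0.
  by rewrite rmorphD !rmorphM /= !rmorphXn /= x2 y2 s2 expr0n mulr0 add0r.
have exp_pow (m : nat) (z : X) :
    nonunits X z -> ideal_exp (nonunits X) m (z ^+ m).
  move=> zN; elim: m => // m ih; apply: sub_ideal_gen.
  by exists z, (z ^+ m); split=> //; rewrite exprS.
have iexp : is_ideal (ideal_exp (nonunits X) n.+1).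
  split=> [J [J0 _] _ //|c v w hv hw J iJ SJ].
  by apply: iJ.2; [apply: hv | apply: hw].
apply: (idealD iexp); apply: (idealM _ iexp); apply: exp_pow.
  by apply/(glued_nonunits1 glueX loc1 loc2); rewrite x1.
by apply/(glued_nonunits2 _ glueX loc1 loc2); rewrite y2.
Qed.

Lemma glued_horner (p q : {poly k}) : p`_0 = q`_0 ->
  exists r, f1 r = horner_alg t1 p /\ f2 r = horner_alg t2 q.
Proof.
move=> pq; have [|r [hr _]] := glueX.2 (horner_alg t1 p) (horner_alg t2 q).
  have aux (Y : comUnitAlgType k) (t : Y) (g : {poly k}) : nonunits Y t ->
      regular t -> is_local Y ->
      (forall u, nonunits Y u -> exists a, u = a * t) ->
      nonunits Y (horner_alg t g - (g`_0)%:A).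
    move=> tN rt locY tP; apply/(dvdpow1 tN locY tP).
    rewrite -(horner_algC t) -rmorphB /=; apply/dvdpow_horner => //.
    by case=> // _; rewrite coefB coefC subrr.
  by exists p`_0; split; [|rewrite pq]; apply: aux.
by exists r.
Qed.

Lemma glued_node : node X.
Proof.
pose ax1 (f : powser2 k) n : {poly k} := \poly_(i < n) (f i 0%N : k).
pose ax2 (f : powser2 k) n : {poly k} := \poly_(j < n) (f 0%N j : k).
have ax0 f n : (ax1 f n)`_0 = (ax2 f n)`_0 by rewrite !coef_poly.
have /choice[lift liftP] : forall pq : {poly k} * {poly k}, exists r,
    pq.1`_0 = pq.2`_0 -> f1 r = horner_alg t1 pq.1 /\ f2 r = horner_alg t2 pq.2.
  move=> [p q] /=; have [/glued_horner[r hr]|npq] := pselect (p`_0 = q`_0).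
    by exists r.
  by exists 0.
pose E n f := lift (ax1 f n, ax2 f n).
have E1 n f : f1 (E n f) = horner_alg t1 (ax1 f n).
  by case: (liftP (ax1 f n, ax2 f n) (ax0 f n)).
have E2 n f : f2 (E n f) = horner_alg t2 (ax2 f n).
  by case: (liftP (ax1 f n, ax2 f n) (ax0 f n)).
pose pr n (b : cross_ring k) :=
  E n (repr (b : {ideal_quot axes_ideal k})).
have prE n f : pr n (to_cross f) = E n f.
  have h := (to_crossP (repr (to_cross f : {ideal_quot axes_ideal k})) f).1
    (reprK _).
  rewrite /pr /E; congr (lift (_, _)); apply/polyP => i; rewrite !coef_poly.
    by rewrite (h i).1.
  by rewrite (h i).2.
have cong n (u v : X) (p p' q q' : {poly k}) :
    f1 u = horner_alg t1 p -> f1 v = horner_alg t1 p' ->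
    f2 u = horner_alg t2 q -> f2 v = horner_alg t2 q' ->
  ideal_exp (nonunits X) n (u - v) <->
  (forall i, (i < n)%N -> p`_i = p'`_i /\ q`_i = q'`_i).
  move=> hu1 hv1 hu2 hv2; rewrite glued_idealP !rmorphB /= hu1 hv1 hu2 hv2.
  rewrite !dvdpow_hornerB //; split=> [[h1 h2] i hi|h].
    by split; [apply: h1 | apply: h2].
  by split=> i /h[].
exists (cross_ring k), pr, (@to_cross k); split; last 2 first.
- exact: to_cross_surj.
- exact: to_cross_eq0.
split.
- move=> n; split.
  + rewrite -[1](rmorph1 (@to_cross k)) prE.
    apply/(cong _ _ _ (ax1 1 n) 1 (ax2 1 n) 1) => //; rewrite ?rmorph1 //.
    by case=> [|i] hi; rewrite !coef_poly hi !coef1.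
  + move=> a b; have [f ->] := to_cross_surj a; have [g ->] := to_cross_surj b.
    rewrite -rmorphD !prE /=.
    apply/(cong _ _ _ (ax1 (f + g) n) (ax1 f n + ax1 g n)
                  (ax2 (f + g) n) (ax2 f n + ax2 g n)) => //;
      rewrite ?rmorphD /= ?E1 ?E2 //.
    by move=> i hi; rewrite !coefD !coef_poly hi.
  + move=> a b; have [f ->] := to_cross_surj a; have [g ->] := to_cross_surj b.
    rewrite -rmorphM !prE /=.
    apply/(cong _ _ _ (ax1 (f * g) n) (ax1 f n * ax1 g n)
                  (ax2 (f * g) n) (ax2 f n * ax2 g n)) => //;
      rewrite ?rmorphM /= ?E1 ?E2 //.
    move=> i hi; rewrite !coefM !coef_poly hi psM_axis1 psM_axis2.
    have lt (j : 'I_i.+1) : (j < n)%N /\ (i - j < n)%N.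
      by split; apply: leq_ltn_trans hi; rewrite ?leq_subr // -ltnS.
    by split; apply: eq_bigr => j _; have [h1 h2] := lt j;
      rewrite !coef_poly h1 h2.
  + move=> c a; have [f ->] := to_cross_surj a; rewrite -linearZ !prE /=.
    apply/(cong _ _ _ (ax1 (c *: f) n) (c *: ax1 f n)
                  (ax2 (c *: f) n) (c *: ax2 f n)) => //;
      rewrite ?linearZ /= ?mulr_algl ?E1 ?E2 //.
    by move=> i hi; rewrite !coefZ !coef_poly hi.
- move=> n a; have [f ->] := to_cross_surj a; rewrite !prE.
  apply/(cong _ _ _ (ax1 f n.+1) (ax1 f n) (ax2 f n.+1) (ax2 f n)) => //.
  by move=> i hi; rewrite !coef_poly hi ltnW.
- move=> a b; have [f ->] := to_cross_surj a; have [g ->] := to_cross_surj b.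
  move=> h; apply/to_crossP => n; have := h n.+1; rewrite !prE.
  move/(cong _ _ _ (ax1 f n.+1) (ax1 g n.+1) (ax2 f n.+1) (ax2 g n.+1)).
  by case/(_ (E1 _ _) (E1 _ _) (E2 _ _) (E2 _ _) n (ltnSn n));
    rewrite !coef_poly ltnSn.
- move=> r hr.
  have /choice[P hP] n := horner_approx t1P n (f1 (r n)) res1.
  have /choice[Q hQ] n := horner_approx t2P n (f2 (r n)) res2.
  have PQS n i : (i < n)%N ->
      (P n.+1)`_i = (P n)`_i /\ (Q n.+1)`_i = (Q n)`_i.
    move=> hi; have [h1 h2] := (glued_idealP n _).1 (hr n).
    have W (Y : comUnitAlgType k) (t y : Y) : dvdpow t n.+1 y -> dvdpow t n y.
      by move=> [a ->]; exists (a * t); rewrite exprS mulrA.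
    have tr (Y : comUnitAlgType k) (t a b c d : Y) :
        dvdpow t n.+1 (a - b) -> dvdpow t n (b - d) -> dvdpow t n (c - d) ->
        dvdpow t n (a - c).
      move=> /W ab bd cd; have -> : a - c = (a - b) + (b - d) - (c - d).
        by rewrite subrKA opprB addrA subrK.
      by apply: dvdpowB => //; apply: dvdpowD.
    move: h1 h2; rewrite !rmorphB /= => h1 h2.
    have := tr _ _ _ _ _ _ (hP n.+1) h1 (hP n).
    have := tr _ _ _ _ _ _ (hQ n.+1) h2 (hQ n).
    by rewrite !dvdpow_hornerB // => q p; split; [apply: p | apply: q].
  have PQE n i : (i < n)%N ->
      (P i.+1)`_i = (P n)`_i /\ (Q i.+1)`_i = (Q n)`_i.
    move=> /subnK <-; elim: (n - i.+1)%N => // d [ih1 ih2].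
    have [|e1 e2] := PQS (d + i.+1)%N i; first by rewrite addnS ltnS leq_addl.
    by rewrite addSn e1 e2.
  have PQ0 : (P 1%N)`_0 = (Q 1%N)`_0.
    have [c [c1 c2]] := glueX.1 (r 1%N).
    have aux (Y : comUnitAlgType k) (t y : Y) (g : {poly k}) : nonunits Y t ->
        regular t ->
        is_local Y -> (forall u, nonunits Y u -> exists a, u = a * t) ->
        nonunits Y (y - c%:A) -> dvdpow t 1 (horner_alg t g - y) -> g`_0 = c.
      move=> tN rt locY tP /(dvdpow1 tN locY tP) yc gy.
      have := dvdpowD gy yc.
      rewrite addrA subrK -(horner_algC t) dvdpow_hornerB //.
      by move=> /(_ 0%N isT); rewrite coefC.
    by rewrite (aux _ _ _ _ t1N rt1 loc1 t1P c1 (hP _))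
               (aux _ _ _ _ t2N rt2 loc2 t2P c2 (hQ _)).
  pose f : powser2 k := fun i j =>
    if j is 0%N then (P i.+1)`_i else if i is 0%N then (Q j.+1)`_j else 0.
  exists (to_cross f) => n; rewrite prE glued_idealP !rmorphB /= E1 E2.
  have close (Y : comUnitAlgType k) (t y : Y) (p q : {poly k}) : nonunits Y t ->
      regular t -> is_local Y -> dvdpow t n (horner_alg t q - y) ->
      (forall i, (i < n)%N -> p`_i = q`_i) -> dvdpow t n (horner_alg t p - y).
    move=> tN rt locY qy /(dvdpow_hornerB tN rt locY) pq.
    by have := dvdpowD pq qy; rewrite addrA subrK.
  split.
    apply: close (hP n) _ => // i hi; rewrite coef_poly hi /=.
    by case: (PQE n i hi).
  apply: close (hQ n) _ => // i hi; rewrite coef_poly hi.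
  by have [_ <-] := PQE n i hi; case: i hi.
Qed.

End GluedNode.

Lemma decomposable_gorenstein_node (k : fieldType) (X : comUnitAlgType k) :
  decomposable X -> gorenstein X -> node X.
Proof.
move=> [X1 [X2 [f1 [f2 [germ1 germ2 glueX]]]]] [M [[_ _ _ extM] freeM]].
have extX := ext1_residue_dim1_free freeM extM.
have [t1 [t1N rt1 t1P]] := glued_gorenstein_principal glueX germ1 germ2 extX.
have [t2 [t2N rt2 t2P]] :=
  glued_gorenstein_principal (glued_sym glueX) germ2 germ1 extX.
have [loc1 res1 _ _ _] := germ1; have [loc2 res2 _ _ _] := germ2.
exact: (glued_node glueX loc1 loc2 res1 res2 t1N t2N rt1 rt2 t1P t2P).
Qed.

Theorem lemma2p13 (R : realType) (X : comUnitAlgType R[i])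
    (hX : curve_germ X) (hdec : decomposable X) (hG : gorenstein X) :
  node X.
Proof. exact: decomposable_gorenstein_node hdec hG. Qed.
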